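(* Let $(A_\mu,B_\nu,\vartriangleright,\vartriangleleft,\rightharpoonup,\leftharpoonup,\theta)$ be a quasi-twilled associative algebra and $r:B\to A$ a weak deformation map in it. Then $(A_{\mu_r},B_{\nu_r},\vartriangleright_r,\vartriangleleft_r,\rightharpoonup_r,\leftharpoonup_r,\theta)$ is a quasi-twilled associative algebra, where for $a,b\in A$ and $x,y\in B$, \begin{align*} \mu_r(a,b)=a\cdot_r b&:=a\cdot_A b-r(\theta(a,b)),\\ \nu_r(x,y)=x\cdot_r y&:=x\cdot_B y+r(x)\vartriangleright y+x\vartriangleleft r(y)+\theta(r(x),r(y)),\\ a\vartriangleright_r x&:=a\vartriangleright x+\theta(a,r(x)),\\ x\vartriangleleft_r a&:=x\vartriangleleft a+\theta(r(x),a),\\ x\rightharpoonup_r a&:=x\rightharpoonup a+r(x)\cdot_A a-r(x\vartriangleleft a)-r(\theta(r(x),a)),\\ a\leftharpoonup_r x&:=a\leftharpoonup x+a\cdot_A r(x)-r(a\vartriangleright x)-r(\theta(a,r(x))). \end{align*}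
   Context: All vector spaces are over a fixed field. A quasi-twilled associative algebra is a (not necessarily unital) associative algebra with a fixed vector space decomposition $\mathbb A=A\oplus B$ such that $B$ is a subalgebra. Equivalently, it is a tuple $(A_\mu,B_\nu,\vartriangleright,\vartriangleleft,\rightharpoonup,\leftharpoonup,\theta)$ of vector spaces $A,B$ and bilinear maps $\mu=\cdot_A:A\times A\to A$, $\nu=\cdot_B:B\times B\to B$, $\vartriangleright:A\times B\to B$, $\vartriangleleft:B\times A\to B$, $\rightharpoonup:B\times A\to A$, $\leftharpoonup:A\times B\to A$, $\theta:A\times A\to B$ such that the multiplication $(a,x)\cdot(b,y)=(a\cdot_A b+a\leftharpoonup y+x\rightharpoonup b,\ x\cdot_B y+a\vartriangleright y+x\vartriangleleft b+\theta(a,b))$ on $A\oplus B$ is associative. A weak deformation map in it is a linear map $r:B\to A$ with $r(x)\cdot_A r(y)+r(x)\leftharpoonup y+x\rightharpoonup r(y)=r\big(x\cdot_B y+r(x)\vartriangleright y+x\vartriangleleft r(y)+\theta(r(x),r(y))\big)$ for all $x,y\in B$. *)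

(* Defs.v *)
From mathcomp Require Import all_boot all_algebra.

Set Implicit Arguments.
Unset Strict Implicit.
Unset Printing Implicit Defensive.

Import GRing.Theory.
Local Open Scope ring_scope.

Section QuasiTwilled.

Variables (K : fieldType) (A B : lmodType K).

(* Raw operations only: bilinearity and associativity are imposed by
   [quasi_twilled]. The harpoons act on A, the triangles on B, and the field
   names record the order of the arguments. *)
Record twilled_ops := TwilledOps {
  mulA : A -> A -> A;    (* mu *)
  mulB : B -> B -> B;    (* nu *)
  trir : A -> B -> B;    (* a |> x *)
  tril : B -> A -> B;    (* x <| a *)
  harpr : B -> A -> A;   (* x -^ a, the right harpoon *)
  harpl : A -> B -> A;   (* a ^- x, the left harpoon *)
  theta : A -> A -> B
}.

Definition twilled_mul (Q : twilled_ops) (u v : A * B) : A * B :=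
  let: (a, x) := u in
  let: (b, y) := v in
  (mulA Q a b + harpl Q a y + harpr Q x b,
   mulB Q x y + trir Q a y + tril Q x b + theta Q a b).

Record quasi_twilled (Q : twilled_ops) : Prop := QuasiTwilled {
  mulA_bilinear : bilinear_for *:%R *:%R (mulA Q);
  mulB_bilinear : bilinear_for *:%R *:%R (mulB Q);
  trir_bilinear : bilinear_for *:%R *:%R (trir Q);
  tril_bilinear : bilinear_for *:%R *:%R (tril Q);
  harpr_bilinear : bilinear_for *:%R *:%R (harpr Q);
  harpl_bilinear : bilinear_for *:%R *:%R (harpl Q);
  theta_bilinear : bilinear_for *:%R *:%R (theta Q);
  twilled_mulA : associative (twilled_mul Q)
}.

Definition weak_deformation_map (Q : twilled_ops) (r : {linear B -> A}) : Prop :=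
  forall x y : B,
    mulA Q (r x) (r y) + harpl Q (r x) y + harpr Q x (r y)
    = r (mulB Q x y + trir Q (r x) y + tril Q x (r y) + theta Q (r x) (r y)).

Definition deform (Q : twilled_ops) (r : {linear B -> A}) : twilled_ops := {|
  mulA := fun a b => mulA Q a b - r (theta Q a b);
  mulB := fun x y =>
    mulB Q x y + trir Q (r x) y + tril Q x (r y) + theta Q (r x) (r y);
  trir := fun a x => trir Q a x + theta Q a (r x);
  tril := fun x a => tril Q x a + theta Q (r x) a;
  harpr := fun x a =>
    harpr Q x a + mulA Q (r x) a - r (tril Q x a) - r (theta Q (r x) a);
  harpl := fun a x =>
    harpl Q a x + mulA Q a (r x) - r (trir Q a x) - r (theta Q a (r x));
  theta := theta Q
|}.

End QuasiTwilled.

(* Main.v *)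
Require Import Defs.
From mathcomp Require Import all_boot all_algebra.

(** The shear [(a, x) |-> (a + r x, x)] of [A * B] is an additive bijection that
    maps [B] onto the graph of [r]. When [r] is a weak deformation map,
    expanding a product of two sheared elements by bilinearity shows that the
    deformed operations are exactly the components of the original
    multiplication transported along the shear ([shear_deform]). The terms of
    the form [r (_)] subtracted in [mu_r] and in the two deformed harpoons come
    from inverting the shear; the weak deformation equation is what makes the
    product of two elements of the graph of [r] stay in that graph, so that [B]
    is a subalgebra for the transported multiplication, which is then again of
    twilled form. Associativity is inherited because the shear is injective, and
    the deformed operations are bilinear as they are obtained from bilinear ones
    by sums, differences and composition with the linear map [r]. *)

Import GRing.Theory.
Local Open Scope ring_scope.

Section Bilinear.

Set Implicit Arguments.
Unset Strict Implicit.

Variables (K : fieldType) (U V W U' V' W' : lmodType K).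
Implicit Types f g : U -> V -> W.

Lemma bilinear_addl f : bilinear_for *:%R *:%R f ->
  forall v, {morph f^~ v : u u' / u + u'}.
Proof. by move=> [fl _] v u u'; have := fl v 1 u u'; rewrite /= !scale1r. Qed.

Lemma bilinear_addr f : bilinear_for *:%R *:%R f ->
  forall u, {morph f u : v v' / v + v'}.
Proof. by move=> [_ fr] u v v'; have := fr u 1 v v'; rewrite /= !scale1r. Qed.

Lemma bilinear_add f g :
  bilinear_for *:%R *:%R f -> bilinear_for *:%R *:%R g ->
  bilinear_for *:%R *:%R (fun u v => f u v + g u v).
Proof.
move=> [fl fr] [gl gr]; split=> [v k u u' | u k v v'] /=.
  by rewrite [f _ v]fl [g _ v]gl /= scalerDr addrACA.
by rewrite fr gr /= scalerDr addrACA.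
Qed.

Lemma bilinear_sub f g :
  bilinear_for *:%R *:%R f -> bilinear_for *:%R *:%R g ->
  bilinear_for *:%R *:%R (fun u v => f u v - g u v).
Proof.
move=> [fl fr] [gl gr]; split=> [v k u u' | u k v v'] /=.
  by rewrite [f _ v]fl [g _ v]gl /= opprD scalerBr addrACA.
by rewrite fr gr /= opprD scalerBr addrACA.
Qed.

Lemma bilinear_postcomp f (h : {linear W -> W'}) :
  bilinear_for *:%R *:%R f -> bilinear_for *:%R *:%R (fun u v => h (f u v)).
Proof.
move=> [fl fr]; split=> [v k u u' | u k v v'] /=.
  by rewrite [f _ v]fl linearP.
by rewrite fr linearP.
Qed.

Lemma bilinear_precompl f (h : {linear U' -> U}) :
  bilinear_for *:%R *:%R f -> bilinear_for *:%R *:%R (fun u v => f (h u) v).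
Proof.
move=> [fl fr]; split=> [v k u u' | u k v v'] /=; last by rewrite fr.
by rewrite linearP; exact: fl.
Qed.

Lemma bilinear_precompr f (h : {linear V' -> V}) :
  bilinear_for *:%R *:%R f -> bilinear_for *:%R *:%R (fun u v => f u (h v)).
Proof.
move=> [fl fr]; split=> [v k u u' | u k v v'] /=; first exact: fl.
by rewrite linearP fr.
Qed.

End Bilinear.

Section Shear.

Set Implicit Arguments.
Unset Strict Implicit.

Variables (K : fieldType) (A B : lmodType K).
Variables (Q : twilled_ops A B) (r : {linear B -> A}).

(** The automorphism of [A * B] that fixes [A] pointwise and maps [B] onto the
    graph of [r]. *)
Definition shear (u : A * B) : A * B := (u.1 + r u.2, u.2).

Lemma shear_inj : injective shear.
Proof. by move=> [a x] [b y] [/[swap] ->] /addIr ->. Qed.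

Lemma shear_deform : quasi_twilled Q -> weak_deformation_map Q r ->
  {morph shear : u v / twilled_mul (deform Q r) u v >-> twilled_mul Q u v}.
Proof.
move=> [mA _ tr tl hr hl th _] wr [a x] [b y]; rewrite /shear /=.
set nu := mulB Q x y + trir Q (r x) y + tril Q x (r y) + theta Q (r x) (r y).
have rnu : _ = r nu := wr x y.
congr pair.
  clearbody nu.
  rewrite (bilinear_addl mA) !(bilinear_addr mA) (bilinear_addl hl).
  rewrite (bilinear_addr hr) !linearD -rnu.
  (* Each subtracted value of [r] is paired with its opposite coming from [r] of
     the [B]-component. *)
  rewrite [LHS](AC (2*4*4*(3*2*2*1))
    ((1*4)*(8*11)*(3*12)*(7*13)*((2*18)*(5*14)*(6*15)*(9*16)*(10*17)))) /=.
  by rewrite !addNr !addr0.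
rewrite (bilinear_addl tr) (bilinear_addr tl) (bilinear_addl th).
rewrite !(bilinear_addr th) /nu.
by rewrite [LHS](AC (4*2*2*1) (1*(5*2)*(7*3)*((9*6)*(8*4)))).
Qed.

Lemma deform_associative : quasi_twilled Q -> weak_deformation_map Q r ->
  associative (twilled_mul (deform Q r)).
Proof.
move=> qQ wr u v w; apply: shear_inj.
by rewrite !shear_deform // (twilled_mulA qQ).
Qed.

End Shear.

Theorem theorem6p12 (K : fieldType) (A B : lmodType K)
    (Q : twilled_ops A B) (r : {linear B -> A}) :
  quasi_twilled Q -> weak_deformation_map Q r -> quasi_twilled (deform Q r).
Proof.
move=> qQ wr; have [mA mB tr tl hr hl th _] := qQ.
have thl := bilinear_precompl r th.
have thr := bilinear_precompr r th.
split=> //=; last exact: deform_associative.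
- exact: bilinear_sub mA (bilinear_postcomp r th).
- do !apply: bilinear_add => //.
  + exact: bilinear_precompl.
  + exact: bilinear_precompr.
  + exact: bilinear_precompr r thl.
- exact: bilinear_add tr thr.
- exact: bilinear_add tl thl.
- apply: bilinear_sub; last exact: bilinear_postcomp r thl.
  apply: bilinear_sub; last exact: bilinear_postcomp r tl.
  exact: bilinear_add hr (bilinear_precompl r mA).
- apply: bilinear_sub; last exact: bilinear_postcomp r thr.
  apply: bilinear_sub; last exact: bilinear_postcomp r tr.
  exact: bilinear_add hl (bilinear_precompr r mA).
Qed.
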